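(* Let $h$ be a learning rule, let $\ell$ be the 0-1 loss, and let $\epsilon(m)$ be a monotonically decreasing function such that $\mathrm{LUF}(h,S,x)\le\epsilon(m)$ for all $S\sim\mathcal{D}^m$ and all $x$. Then $h$ is leave-one-out stable on $\ell$ with rate $\epsilon(m)$.
   Context: Setting: a data point is $z=(x,y)\in\mathbf{X}\times\mathbf{Y}$, where $x$ is a set of features and $y$ a response (class label). Points are drawn from a distribution $\mathcal{D}$, and a dataset $S=(z_1,\dots,z_m)\sim\mathcal{D}^m$ is drawn i.i.d. from $\mathcal{D}$. $S^{(\setminus i)}$ denotes $S$ with its $i$-th element removed. A learning rule $h$ is a randomized mapping from datasets $S$ to models $h_S:\mathbf{X}\to\mathbf{Y}$ (deterministic rules are allowed as a special case). The 0-1 loss $\ell(h_S,z)$ at $z=(x,y)$ is $1$ if $h_S(x)\neq y$ and $0$ otherwise. Leave-one-out unfairness: for a training set $S$ and $x$ in the support of $\mathcal{D}$, $$\mathrm{LUF}(h,S,x)=\max_{i,k}\big|\Pr[h_S(x)=k]-\Pr[h_{S^{(\setminus i)}}(x)=k]\big|,$$ where $i$ ranges over the indices of $S$, $k$ over the class labels, and the probability is over the random choices made by $h$ (for deterministic $h$ these probabilities are $0$ or $1$). Leave-one-out (LOO) stability: for a monotonically decreasing function $\epsilon:\mathbb{N}\to\mathbb{R}$, the learning rule $h$ is leave-one-out stable on loss $\ell$ with rate $\epsilon(m)$ if $$\frac1m\sum_{i=1}^m\mathbb{E}_{S\sim\mathcal{D}^m}\big[|\ell(h_S,z_i)-\ell(h_{S^{(\setminus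 i)}},z_i)|\big]\le\epsilon(m),$$ the expectation being over $S$ and, for randomized $h$, the randomness of $h$ (taken outside the absolute value).
   Formalization: For randomized h the claim fails under independent runs (data-ignoring fair coin: LUF 0, expected loss difference 1/2), so stability is stated for some joint law of (h_S, h_{S∖i}) with the right marginals, chosen per S and i; the feature space is second countable and the labels finite. *)

(* Defs.v *)
From HB Require Import structures.
From mathcomp Require Import all_boot all_order all_algebra.
From mathcomp Require Import all_classical all_reals all_analysis.
Set Implicit Arguments.
Unset Strict Implicit.
Unset Printing Implicit Defensive.
Import Order.TTheory GRing.Theory Num.Theory.
Import numFieldNormedType.Exports.
Local Open Scope classical_set_scope.
Local Open Scope ring_scope.
Local Open Scope ereal_scope.

#[short(type="finMeasurableType")]
HB.structure Definition FinMeasurable d := {T of Finite T & Measurable d T}.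

Notation borel T := (g_sigma_algebraType (@open T)).

Section iid.
Context d (Z : measurableType d) (R : realType).

Definition cons_pair m (p : Z * m.-tuple Z) : m.+1.-tuple Z :=
  [the m.+1.-tuple Z of p.1 :: p.2].

Lemma measurable_cons_pair m :
  measurable_fun [set: Z * m.-tuple Z] (@cons_pair m).
Proof. exact: measurable_cons measurable_fst measurable_snd. Qed.

HB.instance Definition _ m :=
  isMeasurableFun.Build _ _ _ _ (@cons_pair m) (@measurable_cons_pair m).

Fixpoint iid (D : probability Z R) (m : nat) : probability (m.-tuple Z) R :=
  if m is m'.+1 then distribution (D \x iid D m') (@cons_pair m')
  else \d_ [tuple].

End iid.

Definition remove_nth (Z : Type) m (S : m.-tuple Z) (i : 'I_m) :
    m.-1.-tuple Z :=
  [tuple tnth S (lift i j) | j < m.-1].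

Section learning.
Context (R : realType) (T : ptopologicalType) dY (Y : finMeasurableType dY).

Local Notation X := (borel T).

(* Topological support of the first marginal of D. *)
Definition feature_support (D : probability (X * Y)%type R) : set X :=
  [set x : T | forall U : set T, open U -> U x -> 0 < D (U `*` [set: Y])].

(* Models range over a measurable space M, the model t : M being the map
   x |-> predict (t, x).  A learning rule gives, for each size m, a Markov
   kernel from datasets of size m to models; deterministic rules are the
   kernels kdirac mf. *)
Context dM (M : measurableType dM) (predict : {mfun (M * X)%type >-> Y}).

Definition learning_rule := forall m, R.-pker (m.-tuple (X * Y)) ~> M.

Definition loss01 (t : M) (z : X * Y) : R := (predict (t, z.1) != z.2)%:R.

Definition pr_label (P : {measure set M -> \bar R}) (x : X) (k : Y) : R :=
  fine (P [set t | predict (t, x) = k]).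

(* The terms are nonnegative, so for m > 0 the 0 does not affect the max. *)
Definition LUF (h : learning_rule) m (S : m.-tuple (X * Y)) (x : X) : R :=
  \big[Num.max/0%R]_(i < m) \big[Num.max/0%R]_(k : Y)
    `| pr_label (h m S) x k - pr_label (h m.-1 (remove_nth S i)) x k |%R.

(* For each m, S and i, a law of pairs of models whose marginals are the laws
   of h_S and h_{S^(\i)}. *)
Definition joint_run (h : learning_rule)
    (g : forall m, 'I_m -> R.-pker (m.-tuple (X * Y)) ~> (M * M)%type) : Prop :=
  forall m (i : 'I_m) (S : m.-tuple (X * Y)) (A : set M), measurable A ->
    g m i S (A `*` [set: M]) = h m S A /\
    g m i S ([set: M] `*` A) = h m.-1 (remove_nth S i) A.

(* The expectation over the randomness of h of
     |loss01 h_S z_i - loss01 h_{S^(\i)} z_i|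
   depends on the joint law of (h_S, h_{S^(\i)}), which a randomized mapping
   from datasets to models does not determine: it is taken with respect to some
   joint law with the right marginals, measurable in S.  Independence
   is not imposed: a rule that ignores its data and tosses a fair coin would then
   have LUF 0 but an expected loss difference of 1/2.  For deterministic h the
   only joint law is the product of two Dirac masses, and the inner integral is
   the absolute difference of the two losses. *)
Definition loo_stable (D : probability (X * Y)%type R) (h : learning_rule)
    (eps : nat -> R) : Prop :=
  exists2 g, joint_run h g & forall m, (0 < m)%N ->
    (m%:R^-1)%:E *
      \sum_(i < m) \int[iid D m]_S \int[g m i S]_t
        (`| loss01 t.1 (tnth S i) - loss01 t.2 (tnth S i) |%R)%:E
    <= (eps m)%:E.

End learning.

(* Main.v *)
(* Let C be the set of models that are correct at z_i.  For each S and i, draw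
   the pair of events (h_S in C, h_{S^(\i)} in C) from the maximal coupling of
   two Bernoulli laws, then draw the two models independently conditionally on
   these events.  This has the right marginals, and the two losses at z_i differ
   with probability |Pr[h_S(x_i) = y_i] - Pr[h_{S^(\i)}(x_i) = y_i]|, which is
   one of the terms of the maximum LUF(h, S, x_i).  Written as a density with
   respect to the product of the two laws, the coupling is a kernel in S.
   Finally x_i is almost surely in the support of D, because second
   countability makes the complement of the support a null set. *)
From HB Require Import structures.
Require Import Defs.
From mathcomp Require Import all_boot all_order all_algebra.
From mathcomp Require Import all_classical all_reals all_analysis.
From mathcomp Require Import measurable_realfun ring lra.
Set Implicit Arguments.
Unset Strict Implicit.
Unset Printing Implicit Defensive.
Import Order.TTheory GRing.Theory Num.Theory.
Local Open Scope classical_set_scope.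
Local Open Scope ring_scope.
Local Open Scope ereal_scope.

(** * Pullbacks and products of probability kernels *)

Section kernel_pullback.
Context d d' d'' (X' : measurableType d) (X : measurableType d')
  (Y : measurableType d'') (R : realType).
Variables (f : X' -> X) (k : R.-pker X ~> Y).

(** Carrying the proof [mf] in the term lets the kernel structure be inferred from it. *)
Definition kpullback (mf : measurable_fun [set: X'] f) (x : X') :
  {measure set Y -> \bar R} := k (f x).

Variable mf : measurable_fun [set: X'] f.

Let measurable_kpullback U : measurable U ->
  measurable_fun [set: X'] (kpullback mf ^~ U).
Proof. by move=> mU; exact: (measurableT_comp (measurable_kernel k U mU) mf). Qed.

HB.instance Definition _ :=
  isKernel.Build _ _ _ _ _ (kpullback mf) measurable_kpullback.

Let kpullback_prob x : kpullback mf x setT = 1.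
Proof. exact: prob_kernel. Qed.

HB.instance Definition _ :=
  Kernel_isProbability.Build _ _ _ _ _ (kpullback mf) kpullback_prob.

End kernel_pullback.

Section product_kernel.
Context d0 d1 d2 (X : measurableType d0) (M1 : measurableType d1)
  (M2 : measurableType d2) (R : realType).
Variables (k1 : R.-pker X ~> M1) (k2 : R.-pker X ~> M2).

(** Independent draws given [x]: the second kernel, pulled back along the first projection, ignores
    the first draw. *)
Definition prodk : X -> {measure set (M1 * M2) -> \bar R} :=
  mkproduct k1 (kpullback k2 (@measurable_fst _ _ X M1)).

HB.instance Definition _ := Kernel.on prodk.

Lemma prodkX x (B1 : set M1) (B2 : set M2) : measurable B1 -> measurable B2 ->
  prodk x (B1 `*` B2) = k1 x B1 * k2 x B2.
Proof.
move=> mB1 mB2; rewrite /prodk /= /kproduct.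
rewrite (eq_integral (fun y => (\1_B1 y)%:E * k2 x B2)); last first.
  move=> y _; rewrite kernel.intker_indicE/=; last exact: measurableX.
  rewrite /kpullback/= indicE; have [yB|yB] := boolP (y \in B1).
    by rewrite in_xsectionX// mul1e.
  by rewrite notin_xsectionX// measure0 mul0e.
rewrite ge0_integralZr//; first by rewrite integral_indic// setIT.
exact/measurable_EFinP.
Qed.

Let prodk_prob x : prodk x setT = 1.
Proof. by rewrite -setXTT prodkX// !prob_kernel mul1e. Qed.

HB.instance Definition _ :=
  Kernel_isProbability.Build _ _ _ _ _ prodk prodk_prob.

End product_kernel.

(* The joint mass to give to the cell (a, b) of {true, false}^2 so that the
   marginals are p and q and the diagonal has the largest possible mass. *)
Definition cell_weight (R : realType) (p q : bool -> R) (a b : bool) : R :=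
  (if a == b then Num.min (p a) (q a) else Num.max 0 (p a - q a))%R.

(** * Maximal coupling of two Bernoulli laws *)

Section cell_weight.
Local Open Scope ring_scope.
Context (R : realType) (p q : bool -> R).
Hypotheses (p0 : forall a, 0 <= p a) (q0 : forall a, 0 <= q a).
Hypotheses (p1 : p true + p false = 1) (q1 : q true + q false = 1).

Lemma cell_weight_ge0 a b : 0 <= cell_weight p q a b.
Proof.
rewrite /cell_weight; case: eqP => _; first by rewrite le_min p0 q0.
by rewrite le_max lexx.
Qed.

Lemma cell_weight_row a :
  cell_weight p q a true + cell_weight p q a false = p a.
Proof.
rewrite /cell_weight /Num.min /Num.max.
by case: a => /=; do 2!case: ltP => ?; lra.
Qed.

(** Since both laws have mass 1, the excess of [p] over [q] at one boolean is the excess of [q] over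
    [p] at the other. *)
Lemma cell_weight_col b :
  cell_weight p q true b + cell_weight p q false b = q b.
Proof.
rewrite /cell_weight /Num.min /Num.max.
by move: p1 q1; case: b => /= ? ?; do 2!case: ltP => ?; lra.
Qed.

(** The differences [p a - q a] at the two booleans are opposite, so the two positive parts add up
    to an absolute value, the total variation distance. *)
Lemma cell_weight_antidiag :
  cell_weight p q true false + cell_weight p q false true =
  `|p true - q true|.
Proof.
rewrite /cell_weight /Num.max /=.
move: p1 q1; have [h|h] := leP (p true) (q true) => ? ?.
  by rewrite ler0_norm; do 2?case: ltP => ?; lra.
by rewrite gtr0_norm; do 2?case: ltP => ?; lra.
Qed.

(** A nonnegative cell is bounded by its row sum [p a] and by its column sum [q b], one of which is
    zero. *)
Lemma cell_weight_eq0 a b : p a * q b = 0 -> cell_weight p q a b = 0.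
Proof.
have : cell_weight p q a b <= p a.
  rewrite -(cell_weight_row a); case: b; rewrite ?lerDl ?lerDr;
    exact: cell_weight_ge0.
have : cell_weight p q a b <= q b.
  rewrite -(cell_weight_col b); case: a; rewrite ?lerDl ?lerDr;
    exact: cell_weight_ge0.
have := cell_weight_ge0 a b.
by move=> ? ? ? /eqP; rewrite mulf_eq0 => /orP[] /eqP ?; lra.
Qed.

Lemma cell_weightK a b :
  cell_weight p q a b / (p a * q b) * (p a * q b) = cell_weight p q a b.
Proof.
have [/[dup] /cell_weight_eq0 -> ->|?] := eqVneq (p a * q b) 0.
  by rewrite mulr0.
by rewrite mulfVK.
Qed.

End cell_weight.

(** * Lifting the Bernoulli coupling to a coupling of two kernels *)

Section maximal_coupling.
Context d0 d1 d2 (X : measurableType d0) (M1 : measurableType d1)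
  (M2 : measurableType d2) (R : realType).
Variables (k1 : R.-pker X ~> M1) (k2 : R.-pker X ~> M2).

Section cell.
Context d (M : measurableType d) (k : R.-pker X ~> M).
Variables (A : set (X * M)) (mA : measurable A).

(** The two blocks into which the event, which may vary with [x], splits the space [M]. *)
Definition cell (b : bool) (x : X) : set M :=
  xsection (if b then A else ~` A) x.

Definition cell_prob (x : X) (b : bool) : R := fine (k x (cell b x)).

Lemma measurable_cell b x : measurable (cell b x).
Proof. by apply: measurable_xsection; case: b => //; exact: measurableC. Qed.

Lemma cellC x : cell false x = ~` cell true x.
Proof.
apply/seteqP; split => y; rewrite /cell.
  by move=> /xsectionP nAy /xsectionP.
by move=> nAy; apply/xsectionP => Ay; apply: nAy; apply/xsectionP.
Qed.

Lemma pker_fin_num x B : measurable B -> k x B \is a fin_num.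
Proof.
move=> mB; rewrite ge0_fin_numE//; apply: (@le_lt_trans _ _ 1); last exact: ltry.
by rewrite -(prob_kernel (s := k) x); apply: le_measure; rewrite ?inE.
Qed.

Lemma cell_probE x b : k x (cell b x) = (cell_prob x b)%:E.
Proof. by rewrite fineK// pker_fin_num//; exact: measurable_cell. Qed.

Lemma cell_prob_ge0 x b : (0 <= cell_prob x b)%R.
Proof. by rewrite fine_ge0. Qed.

Lemma cell_split x B : measurable B ->
  k x B = k x (B `&` cell true x) + k x (B `&` cell false x).
Proof.
move=> mB; rewrite cellC -setDE addeC -measureDI//; exact: measurable_cell.
Qed.

Lemma cell_prob_sum x : (cell_prob x true + cell_prob x false = 1)%R.
Proof.
apply: EFin_inj; rewrite EFinD -!cell_probE -(prob_kernel (s := k) x).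
by rewrite (cell_split _ measurableT) !setTI.
Qed.

Lemma cell_prob_eq0 x b B : measurable B -> cell_prob x b = 0%R ->
  k x (B `&` cell b x) = 0.
Proof.
move=> mB h; apply/eqP; rewrite -measure_le0 -[leRHS]/(0%R%:E) -h -cell_probE.
by apply: le_measure; rewrite ?inE//; [apply: measurableI => //|];
  exact: measurable_cell.
Qed.

Lemma measurable_cell_prob b : measurable_fun setT (cell_prob ^~ b).
Proof.
apply: (measurableT_comp (fine_measurable measurableT)).
apply: measurable_fun_xsection_finite_kernel; rewrite inE.
by case: b => //; exact: measurableC.
Qed.

End cell.

Variables (A1 : set (X * M1)) (mA1 : measurable A1).
Variables (A2 : set (X * M2)) (mA2 : measurable A2).

Let p := cell_prob k1 A1.
Let q := cell_prob k2 A2.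

Let rect a b x := cell A1 a x `*` cell A2 b x.

Let measurable_rect a b x : measurable (rect a b x).
Proof. by apply: measurableX; exact: measurable_cell. Qed.

(* If p x a * q x b = 0 then this is the junk value 0, which is the right one
   because the weight of that cell is then 0 (cell_weight_eq0). *)
Let density x a b : R := (cell_weight (p x) (q x) a b / (p x a * q x b))%R.

Let density_ge0 x a b : (0 <= density x a b)%R.
Proof.
by rewrite divr_ge0//; [apply: cell_weight_ge0|apply: mulr_ge0] => *;
  exact: cell_prob_ge0.
Qed.

(** On a rectangle of nonzero product mass, this is the cell weight times the product of the two
    conditional laws. *)
Let piece a b x : {measure set (M1 * M2) -> \bar R} :=
  mscale (NngNum (density_ge0 x a b))
    (mrestr (prodk k1 k2 x) (measurable_rect a b x)).

Definition coupling (x : X) :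
    {measure set (M1 * M2) -> \bar R} :=
  measure_add (measure_add (piece true true x) (piece true false x))
              (measure_add (piece false true x) (piece false false x)).

Let couplingE x B : coupling x B =
  (density x true true)%:E * prodk k1 k2 x (B `&` rect true true x) +
  (density x true false)%:E * prodk k1 k2 x (B `&` rect true false x) +
  ((density x false true)%:E * prodk k1 k2 x (B `&` rect false true x) +
   (density x false false)%:E * prodk k1 k2 x (B `&` rect false false x)).
Proof. rewrite [LHS]measure_addE. by congr (_ + _); exact: measure_addE. Qed.

Let measurable_density a b : measurable_fun setT (fun x => density x a b).
Proof.
have mp c : measurable_fun setT (p ^~ c) by exact: measurable_cell_prob.
have mq c : measurable_fun setT (q ^~ c) by exact: measurable_cell_prob.
apply: measurable_funM.
  rewrite /cell_weight; case: (a == b); first exact: measurable_minr.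
  by apply: measurable_maxr => //; exact: measurable_funB.
(* Measurability of the inverse is in the library only through powR. *)
rewrite (_ : (fun x => _) = (fun x => (p x a * q x b) `^ (-1))%R); last first.
  by apply/funext => x; rewrite powR_inv1// mulr_ge0//; exact: cell_prob_ge0.
apply: (measurableT_comp (measurable_powR _)).
exact: measurable_funM.
Qed.

Let measurable_rect_graph a b :
  measurable [set xt : X * (M1 * M2) | rect a b xt.1 xt.2].
Proof.
have mc1 : measurable (if a then A1 else ~` A1).
  by case: a => //; exact: measurableC.
have mc2 : measurable (if b then A2 else ~` A2).
  by case: b => //; exact: measurableC.
rewrite (_ : [set _ | _] =
    (fun xt => (xt.1, xt.2.1)) @^-1` (if a then A1 else ~` A1) `&`
    (fun xt => (xt.1, xt.2.2)) @^-1` (if b then A2 else ~` A2)); last first.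
  by apply/seteqP; split => -[x [t1 t2]] [] /=;
    [move=> /xsectionP ? /xsectionP|move=> ? ?; split; apply/xsectionP].
apply: measurableI; rewrite -[X in measurable X]setTI.
- suff mf : measurable_fun setT (fun xt : X * (M1 * M2) => (xt.1, xt.2.1)).
    exact: mf.
  apply: measurable_fun_pair => //.
  exact: (measurableT_comp measurable_fst measurable_snd).
- suff mf : measurable_fun setT (fun xt : X * (M1 * M2) => (xt.1, xt.2.2)).
    exact: mf.
  apply: measurable_fun_pair => //.
  exact: (measurableT_comp measurable_snd measurable_snd).
Qed.

Let measurable_coupling B : measurable B ->
  measurable_fun setT (coupling ^~ B).
Proof.
move=> mB; under eq_fun do rewrite couplingE.
suff h a b : measurable_fun setT (fun x => (density x a b)%:E *
    prodk k1 k2 x (B `&` rect a b x)).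
  by apply: emeasurable_funD; apply: emeasurable_funD; exact: h.
apply: emeasurable_funM; first exact/measurable_EFinP.
(* The set measured moves with [x]; it is the [x]-section of one fixed measurable set, which is
   where joint measurability of the rectangles enters. *)
rewrite (_ : (fun x => _) = (fun x => prodk k1 k2 x (xsection
    ((snd @^-1` B) `&` [set xt : X * (M1 * M2) | rect a b xt.1 xt.2]) x))).
  apply: measurable_fun_xsection_finite_kernel; rewrite inE.
  by apply: measurableI => //; rewrite -[X in measurable X]setTI;
    exact: measurable_snd.
apply/funext => x; congr (prodk _ _ _ _).
by rewrite xsectionI xsection_preimage_snd; congr (_ `&` _);
  apply/seteqP; split => t; [move=> ?; apply/xsectionP|move=> /xsectionP].
Qed.

HB.instance Definition _ := isKernel.Build _ _ _ _ _ coupling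
  measurable_coupling.

Let coupling_rect x B1 B2 : measurable B1 -> measurable B2 ->
  forall a b, prodk k1 k2 x (B1 `*` B2 `&` rect a b x) =
    k1 x (B1 `&` cell A1 a x) * k2 x (B2 `&` cell A2 b x).
Proof.
by move=> mB1 mB2 a b; rewrite -setXI prodkX//; apply: measurableI => //;
  exact: measurable_cell.
Qed.

Lemma coupling_fst x B : measurable B ->
  coupling x (B `*` setT) = k1 x B.
Proof.
move=> mB; rewrite couplingE !coupling_rect// !setTI.
rewrite [RHS](cell_split k1 mA1)//.
(* It suffices to argue row by row: the pieces of row [a] together must restore the mass of [B]
   inside that row's cell. *)
suff h a : (density x a true)%:E * (k1 x (B `&` cell A1 a x) *
      k2 x (cell A2 true x)) +
    (density x a false)%:E * (k1 x (B `&` cell A1 a x) *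
      k2 x (cell A2 false x)) = k1 x (B `&` cell A1 a x).
  by rewrite !h.
rewrite !(cell_probE k2 mA2).
have [pa0|pa0] := eqVneq (p x a) 0%R.
  by rewrite (cell_prob_eq0 (k := k1))// !mul0e !mule0 adde0.
have /fineK <- : k1 x (B `&` cell A1 a x) \is a fin_num.
  by apply: pker_fin_num; apply: measurableI => //; exact: measurable_cell.
rewrite -!EFinM -EFinD; congr EFin; set f := fine _.
(* Factoring out [f / p x a] exposes the products that [cell_weightK] cancels; the row sum is then
   [p x a]. *)
transitivity (f * (density x a true * (p x a * q x true) +
  density x a false * (p x a * q x false)) / p x a)%R; first by rewrite /q; field.
rewrite !cell_weightK ?cell_weight_row ?mulfK//;
  by [move=> *; exact: cell_prob_ge0|exact: cell_prob_sum].
Qed.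

Lemma coupling_snd x B : measurable B ->
  coupling x (setT `*` B) = k2 x B.
Proof.
(* Here [addeACA] regroups the four cells by column. *)
move=> mB; rewrite couplingE !coupling_rect// !setTI addeACA.
rewrite [RHS](cell_split k2 mA2)//.
suff h b : (density x true b)%:E * (k1 x (cell A1 true x) *
      k2 x (B `&` cell A2 b x)) +
    (density x false b)%:E * (k1 x (cell A1 false x) *
      k2 x (B `&` cell A2 b x)) = k2 x (B `&` cell A2 b x).
  by rewrite !h.
rewrite !(cell_probE k1 mA1).
have [qb0|qb0] := eqVneq (q x b) 0%R.
  by rewrite (cell_prob_eq0 (k := k2))// !mule0 adde0.
have /fineK <- : k2 x (B `&` cell A2 b x) \is a fin_num.
  by apply: pker_fin_num; apply: measurableI => //; exact: measurable_cell.
rewrite -!EFinM -EFinD; congr EFin; set f := fine _.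
transitivity (f * (density x true b * (p x true * q x b) +
  density x false b * (p x false * q x b)) / q x b)%R; first by rewrite /p; field.
rewrite !cell_weightK ?cell_weight_col ?mulfK//;
  by [move=> *; exact: cell_prob_ge0|exact: cell_prob_sum].
Qed.

Let coupling_prob x : coupling x setT = 1.
Proof. by rewrite -setXTT coupling_fst// prob_kernel. Qed.

HB.instance Definition _ := Kernel_isProbability.Build _ _ _ _ _
  coupling coupling_prob.

(** The disagreement event is the union of the two antidiagonal rectangles. Each meets only its own
    piece, so its mass is its cell weight. *)
Lemma coupling_disagree x :
  coupling x (xsection A1 x `*` ~` xsection A2 x `|`
                      ~` xsection A1 x `*` xsection A2 x) =
  `|fine (k1 x (xsection A1 x)) - fine (k2 x (xsection A2 x))|%:E.
Proof.
have mc1 b := measurable_cell mA1 b x.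
have mc2 b := measurable_cell mA2 b x.
rewrite -[xsection A1 x]/(cell A1 true x) -[xsection A2 x]/(cell A2 true x).
rewrite -!cellC.
transitivity (coupling x (cell A1 true x `*` cell A2 false x) +
              coupling x (cell A1 false x `*` cell A2 true x)).
  apply: measureU; [exact: measurableX|exact: measurableX|].
  by rewrite -setXI cellC setICr set0X.
rewrite !couplingE !coupling_rect// !cellC !setIid.
rewrite ?(setICl, setICr) !measure0 !(mule0, mul0e, adde0, add0e) -!cellC.
rewrite !cell_probE// -!EFinM -EFinD !cell_weightK ?cell_weight_antidiag//;
  by [move=> *; exact: cell_prob_ge0|exact: cell_prob_sum].
Qed.

End maximal_coupling.

(** * Coordinates of i.i.d. samples and the support of the feature marginal *)

Lemma measurable_eq_set d dY (U : measurableType d) (Y : finMeasurableType dY)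
    (f g : U -> Y) : (forall k : Y, measurable [set k]) ->
  measurable_fun setT f -> measurable_fun setT g ->
  measurable [set u | f u = g u].
Proof.
move=> mk mf mg; rewrite (_ : [set u | _] =
    \bigcup_(k in [set: Y]) (f @^-1` [set k] `&` g @^-1` [set k])); last first.
  apply/seteqP; split => [u /= fg|u [k _ [/= -> ->]]//].
  by exists (f u) => //; split.
apply: fin_bigcup_measurable; first exact: finite_finset.
move=> k _; apply: measurableI; rewrite -[X in measurable X]setTI;
  [exact: mf|exact: mg].
Qed.

(** Induction on [m]: coordinate 0 depends on the first factor of the product alone, any later one
    on the second, and the other factor has mass 1. *)
Lemma iid_tnth d (Z : measurableType d) (R : realType) (D : probability Z R)
    m (i : 'I_m) (B : set Z) : measurable B ->
  iid D m [set S | B (tnth S i)] = D B.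
Proof.
elim: m i => [[]//|m IH] i mB.
rewrite /= /distribution /pushforward.
case: (unliftP ord0 i) => [j ->|->]; last first.
  rewrite (_ : _ @^-1` _ = B `*` setT); last first.
    by apply/seteqP; split => -[z S] /=; rewrite /cons_pair/= ?tnth0//; case.
  by rewrite product_measure1E// -[RHS]mule1 -(probability_setT (iid D m)).
rewrite (_ : _ @^-1` _ = setT `*` [set S | B (tnth S j)]); last first.
  by apply/seteqP; split => -[z S] /=; rewrite /cons_pair/= ?tnthS//; case.
rewrite product_measure1E//; last first.
  rewrite -[X in measurable X]setTI.
  by have := @measurable_tnth _ Z m j measurableT B mB.
by rewrite -[RHS]mul1e -(IH j mB) -(probability_setT D).
Qed.

Lemma measurable_remove_nth d (Z : measurableType d) m (i : 'I_m) :
  measurable_fun setT (fun S : m.-tuple Z => remove_nth S i).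
Proof.
apply/measurable_fun_tnthP => j.
rewrite (_ : _ \o _ = (fun S : m.-tuple Z => tnth S (lift i j))).
  exact: measurable_tnth.
by apply/funext => S /=; rewrite tnth_mktuple.
Qed.

(** A point outside the support has a null open neighbourhood, hence a null basic one; countably
    many null basic strips cover all such points. *)
Lemma negligible_not_feature_support (R : realType) (T : ptopologicalType)
    dY (Y : finMeasurableType dY) (D : probability (borel T * Y)%type R) :
  @second_countable T ->
  D.-negligible [set z : borel T * Y | ~ feature_support D z.1].
Proof.
move=> [B cB [Bo Bb]].
have [f fB] : exists f : nat -> set T, B `<=` range f.
  (* No function on [nat] has empty range, so an empty base is treated apart. *)
  have [->|/set0P[b0 Bb0]] := eqVneq B set0; first by exists (fun=> set0).
  have /pfcard_geP[B0|[f]] : ([set: nat] #>= B)%card by [].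
    by rewrite B0 in Bb0.
  by exists f; have := @surj _ _ _ _ f.
(* Replacing the other strips by [set0] makes every [F n] null, so that the whole countable union is
   negligible. *)
pose F n : set (borel T * Y) :=
  if pselect (open (f n) /\ D (f n `*` setT) = 0) then f n `*` setT else set0.
apply: (negligibleS (A := \bigcup_n F n)); last first.
  apply: negligible_bigcup => n; rewrite /F.
  case: pselect => [[on D0]|ns] /=; last exact: negligible_set0.
  apply/negligibleP => //; apply: measurableX => //.
  exact: sub_sigma_algebra.
move=> [x y] /= nsupp.
have [U [oU Ux DU]] : exists U : set T,
    [/\ open U, U x & D (U `*` [set: Y]) = 0].
  apply: contrapT => noU; apply: nsupp => U oU Ux.
  rewrite lt0e measure_ge0 andbT; apply/eqP => DU; apply: noU.
  by exists U.
have [V [BV Vx] VU] := Bb x U (open_nbhs_nbhs (conj oU Ux)).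
have [n _ fnV] := fB _ BV.
exists n => //; rewrite /F fnV; case: pselect => [?|[]] /=; first by split.
split; first exact: Bo.
apply/eqP; rewrite -measure_le0 -[leRHS]DU; apply: le_measure; rewrite ?inE.
- by apply: measurableX => //; apply: sub_sigma_algebra; exact: Bo.
- by apply: measurableX => //; exact: sub_sigma_algebra.
- by move=> [a b] [/= Va _]; split => //; exact: VU.
Qed.

Lemma ae_feature_support (R : realType) (T : ptopologicalType)
    dY (Y : finMeasurableType dY) (D : probability (borel T * Y)%type R)
    m (i : 'I_m) : @second_countable T ->
  {ae iid D m, forall S, feature_support D (tnth S i).1}.
Proof.
move=> T_sc; have [N [mN DN0 subN]] := negligible_not_feature_support D T_sc.
exists [set S | N (tnth S i)]; split.
- rewrite -[X in measurable X]setTI.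
  by have := @measurable_tnth _ _ m i measurableT N mN.
- by rewrite iid_tnth.
- by move=> S /= nS; apply: subN.
Qed.

(** * Coupling the models trained with and without one point *)

Section loo_coupling.
Context (R : realType) (T : ptopologicalType) (dY : measure_display)
  (Y : finMeasurableType dY) (dM : measure_display) (M : measurableType dM).
Hypothesis Y_discrete : forall k : Y, measurable [set k].
Variables (predict : {mfun (M * borel T)%type >-> Y}).
Variables (h : learning_rule R T Y M).

(** The set of models correct at the [i]-th point depends on the dataset, so it is encoded as the
    section of a graph. *)
Definition correct_graph m (i : 'I_m) : set (m.-tuple (borel T * Y) * M) :=
  [set St | predict (St.2, (tnth St.1 i).1) = (tnth St.1 i).2].

Lemma measurable_correct_graph m (i : 'I_m) : measurable (correct_graph i).
Proof.
have mz : measurable_fun setT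
    (fun St : m.-tuple (borel T * Y) * M => tnth St.1 i).
  by apply: (measurableT_comp (measurable_tnth i) measurable_fst).
apply: measurable_eq_set => //.
  apply: (measurableT_comp (measurable_funPT predict)).
  apply: measurable_fun_pair => //.
  exact: (measurableT_comp measurable_fst mz).
exact: (measurableT_comp measurable_snd mz).
Qed.

(** Pulling the second law back along the removal makes both laws kernels in the full dataset, where
    the removed point is still available to define the event. *)
Definition loo_coupling m (i : 'I_m) :
    R.-pker (m.-tuple (borel T * Y)) ~> (M * M)%type :=
  coupling (h m) (kpullback (h m.-1) (measurable_remove_nth i))
    (measurable_correct_graph i) (measurable_correct_graph i).

Lemma joint_run_loo_coupling : joint_run h loo_coupling.
Proof.
move=> m i S A mA; split; [exact: coupling_fst|].
by rewrite /loo_coupling coupling_snd.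
Qed.

Lemma correct_sectionE m (i : 'I_m) S :
  xsection (correct_graph i) S =
  [set t | predict (t, (tnth S i).1) = (tnth S i).2].
Proof. by rewrite xsectionE. Qed.

Definition label_gap m (i : 'I_m) (S : m.-tuple (borel T * Y)) : R :=
  `|pr_label predict (h m S) (tnth S i).1 (tnth S i).2 -
    pr_label predict (h m.-1 (remove_nth S i)) (tnth S i).1 (tnth S i).2|%R.

(** The loss difference is the indicator that exactly one of the two models is correct, so its
    integral is the mass given by [coupling_disagree]. *)
Lemma integral_loo_coupling m (i : 'I_m) S :
  \int[loo_coupling i S]_t
    (`|loss01 R predict t.1 (tnth S i) - loss01 R predict t.2 (tnth S i)|%R)%:E =
  (label_gap i S)%:E.
Proof.
rewrite /label_gap /pr_label -correct_sectionE.
rewrite -(coupling_disagree (h m)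
  (kpullback (h m.-1) (measurable_remove_nth i))
  (measurable_correct_graph i) (measurable_correct_graph i)).
set A := xsection _ _; set disagree := _ `|` _.
have mA : measurable A.
  by apply: measurable_xsection; exact: measurable_correct_graph.
have mdis : measurable disagree.
  by apply: measurableU; apply: measurableX => //; exact: measurableC.
transitivity (\int[loo_coupling i S]_t (\1_disagree t)%:E); last first.
  by rewrite integral_indic// setIT.
apply: eq_integral => -[t1 t2] _; congr EFin.
have lossE t : loss01 R predict t (tnth S i) = (t \notin A)%:R%R.
  rewrite /loss01; congr (nat_of_bool (~~ _))%:R%R.
  by apply/eqP/idP; rewrite /A correct_sectionE inE.
rewrite !lossE indicE.
have -> : ((t1, t2) \in disagree) = (t1 \in A) (+) (t2 \in A).
  rewrite /disagree in_setU !in_setX !in_setC /=.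
  by case: (t1 \in A); case: (t2 \in A).
by case: (t1 \in A); case: (t2 \in A) => /=;
  rewrite ?subrr ?subr0 ?sub0r ?normrN ?normr0 ?normr1.
Qed.

Lemma measurable_label_gap m (i : 'I_m) : measurable_fun setT (label_gap i).
Proof.
have mc := measurable_correct_graph i.
apply: measurableT_comp => //; apply: measurable_funB.
  have := measurable_cell_prob (h m) mc true.
  by under eq_fun do rewrite /cell_prob /cell correct_sectionE.
have := measurable_cell_prob
  (kpullback (h m.-1) (measurable_remove_nth i)) mc true.
by under eq_fun do rewrite /cell_prob /cell correct_sectionE.
Qed.

(** The gap is the term of the double maximum at index [i] and at the true label of the [i]-th
    point. *)
Lemma label_gap_le_LUF m (i : 'I_m) S :
  (label_gap i S <= LUF predict h S (tnth S i).1)%R.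
Proof.
rewrite /LUF; apply: le_trans; last exact: (le_bigmax _ _ i).
exact: (le_bigmax _ (fun k => `|pr_label predict (h m S) (tnth S i).1 k -
  pr_label predict (h m.-1 (remove_nth S i)) (tnth S i).1 k|%R) (tnth S i).2).
Qed.

End loo_coupling.

(* Averaging the bound over samples and indices *)
Local Close Scope ereal_scope.

Theorem proposition3p2 (R : realType)
    (T : ptopologicalType) (T_sc : @second_countable T)
    (dY : measure_display) (Y : finMeasurableType dY)
    (Y_discrete : forall k : Y, measurable [set k])
    (D : probability (borel T * Y)%type R)
    (dM : measure_display) (M : measurableType dM)
    (predict : {mfun (M * borel T)%type >-> Y})
    (h : learning_rule R T Y M) (eps : nat -> R)
    (eps_decr : forall m n : nat, (m <= n)%N -> eps n <= eps m)
    (LUF_le : forall m : nat, (0 < m)%N ->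
       {ae iid D m, forall S : m.-tuple (borel T * Y),
          forall x, feature_support D x -> LUF predict h S x <= eps m}) :
  loo_stable predict D h eps.
Proof.
exists (loo_coupling Y_discrete predict h); first exact: joint_run_loo_coupling.
move=> m m0.
(* Two almost sure events are combined: the bound on [LUF] over the support, and the [i]-th feature
   lying in the support. *)
have gap_le i : {ae iid D m, forall S, label_gap predict h i S <= eps m}.
  near=> S; apply: le_trans (label_gap_le_LUF _ _ _ _) _.
  have supp : feature_support D (tnth S i).1.
    by near: S; exact: ae_feature_support.
  by move: (tnth S i).1 supp; near: S; exact: LUF_le.
(* Gaps are nonnegative, so a negative [eps m] would violate [gap_le] on every sample, and the whole
   space would be null. The index 0 exists because [m] is positive. *)
have eps0 : 0 <= eps m.
  rewrite leNgt; apply/negP => epslt0.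
  have [N [mN N0 subN]] := gap_le (Ordinal m0).
  have : iid D m setT = 0%E.
    apply/eqP; rewrite -measure_le0 -N0; apply: le_measure; rewrite ?inE//.
    move=> S _; apply: subN => /= /le_lt_trans /(_ epslt0).
    by rewrite ltNge normr_ge0.
  by rewrite probability_setT => /eqP; rewrite onee_eq0.
have int_le i : (\int[iid D m]_S \int[loo_coupling Y_discrete predict h i S]_t
    `|loss01 R predict t.1 (tnth S i) - loss01 R predict t.2 (tnth S i)|%:E
    <= (eps m)%:E)%E.
  under eq_integral do rewrite integral_loo_coupling.
  apply: (@le_trans _ _ (\int[iid D m]_S (eps m)%:E)%E).
    apply: ae_ge0_le_integral => //.
    - by move=> S _; rewrite lee_fin normr_ge0.
    - by apply/measurable_EFinP; exact: measurable_label_gap.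
    - by near=> S => _; rewrite lee_fin; near: S; exact: gap_le.
  by rewrite integral_cst// -[leRHS]mule1 -(probability_setT (iid D m)).
apply: (@le_trans _ _ (m%:R^-1%:E * \sum_(i < m) (eps m)%:E)%E).
  by apply: lee_wpmul2l; [rewrite lee_fin invr_ge0|exact: lee_sum].
rewrite sumEFin big_const_ord iter_addr_0 -EFinM lee_fin -[eps m *+ m]mulr_natr.
by rewrite mulrCA mulVf ?mulr1// pnatr_eq0 -lt0n.
Unshelve. all: by end_near.
Qed.
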